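(* Let $\mathbf{E}$ be a finite set, $n\in\mathbb{N}$, let $\mathsf{G}_{1},\ldots,\mathsf{G}_{n+1}$ be $|\mathbf{E}|\times|\mathbf{E}|$ matrices with non-negative off-diagonal entries and zero row sums, and let $q_{1},\ldots,q_{n}>0$. Let $Z=(N,Y)$ be the time-homogeneous Markov chain on $(\widetilde{\Omega},\widetilde{\mathcal{F}},\widetilde{\mathbb{P}})$ with state space $\{0,\ldots,n\}\times\mathbf{E}$ and generator $\widetilde{\mathsf{G}}$ whose diagonal blocks are $\mathsf{G}_{k+1}-q_{k+1}\mathsf{I}$ on $\{k\}\times\mathbf{E}$ ($k=0,\ldots,n-1$) and $\mathsf{G}_{n+1}$ on $\{n\}\times\mathbf{E}$, whose blocks from $\{k\}\times\mathbf{E}$ to $\{k+1\}\times\mathbf{E}$ are $q_{k+1}\mathsf{I}$, and all other blocks zero. Let $\widetilde{\mathbb{P}}^{i}(\cdot)=\widetilde{\mathbb{P}}(\cdot\mid Z_0=(0,i))$, $S_k=\inf\{t\ge0:N_t=k\}$, and $\widetilde{\mathcal{F}}^Y_\infty=\sigma(Y_t,t\ge0)$. For $i\in\mathbf{E}$ and $0<s_1<\cdots<s_n$, let $\overline{\mathbb{P}}^{i}=\overline{\mathbb{P}}^{i}(\cdot\,;s_1,\ldots,s_n)$ be the probability measure on $(\widetilde{\Omega},\widetilde{\mathcal{F}}^Y_\infty)$ which on every cylinder set $A=\{(Y_{u_1},\ldots,Y_{u_m})\in B\}$ equals $$\lim_{\Delta s_k\to0,\,k=1,\ldots,n}\frac{\widetilde{\mathbb{P}}^{i}(A,\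 s_k<S_k\le s_k+\Delta s_k,\ k=1,\ldots,n)}{\widetilde{\mathbb{P}}^{i}(s_k<S_k\le s_k+\Delta s_k,\ k=1,\ldots,n)}.$$ Then for any $i\in\mathbf{E}$ and $0<s_1<\cdots<s_n$, under $\overline{\mathbb{P}}^{i}$ the process $Y$ is a time-inhomogeneous Markov chain with generator $\mathsf{G}=\{\mathsf{G}_t,t\ge0\}$, where, with $s_0=0$, $\mathsf{G}_t=\mathsf{G}_k$ for $s_{k-1}\le t<s_k$ ($k=1,\ldots,n$) and $\mathsf{G}_t=\mathsf{G}_{n+1}$ for $t\ge s_n$. In particular, if $X$ is a time-inhomogeneous Markov chain with state space $\mathbf{E}$ and generator $\mathsf{G}$ on a probability space $(\Omega,\mathscr{F},\mathbb{P})$ with $\mathbb{P}(X_0=i)>0$, and $\mathbb{P}^i=\mathbb{P}(\cdot\mid X_0=i)$, then $X$ under $\mathbb{P}^i$ and $Y$ under $\overline{\mathbb{P}}^{i}$ have the same law.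
   Context: Such a limit exists on cylinder sets and extends uniquely to a probability measure on $\widetilde{\mathcal{F}}^Y_\infty$ (Theorem 3.2 of the paper). *)

(* Defs.v *)
From HB Require Import structures.
From mathcomp Require Import all_boot all_order all_algebra.
From mathcomp Require Import all_classical all_reals all_analysis.
Set Implicit Arguments. Unset Strict Implicit. Unset Printing Implicit Defensive.
Import Order.TTheory GRing.Theory Num.Theory.
Import numFieldNormedType.Exports.
Local Open Scope classical_set_scope.
Local Open Scope ring_scope.

Section Defs.
Variable R : realType.

Definition fmat (T : finType) := T -> T -> R.
Definition fid (T : finType) : fmat T := fun x y => (x == y)%:R.
Definition fmul (T : finType) (A B : fmat T) : fmat T :=
  fun x y => \sum_(z : T) A x z * B z y.
Definition fpow (T : finType) (A : fmat T) (k : nat) : fmat T :=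
  iter k (fmul A) (@fid T).
Definition fexp (T : finType) (t : R) (A : fmat T) : fmat T :=
  fun x y => limn (series (fun k => t ^+ k / (k`!)%:R * fpow A k x y)).

Definition is_generator (T : finType) (A : fmat T) : Prop :=
  (forall x y, x != y -> 0 <= A x y) /\ (forall x, \sum_(y : T) A x y = 0).

Fixpoint path_ev (Om : Type) (T : finType) (Z : R -> Om -> T)
    (t : R) (x : T) (s : seq (R * T)) : set Om :=
  match s with
  | [::] => [set w | Z t w = x]
  | (u, y) :: s' => [set w | Z t w = x] `&` path_ev Z u y s'
  end.
Fixpoint path_prob (T : finType) (Ptr : R -> R -> fmat T)
    (t : R) (x : T) (s : seq (R * T)) : R :=
  match s with
  | [::] => 1
  | (u, y) :: s' => Ptr t u x y * path_prob Ptr u y s'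
  end.

(* Z is a (possibly time-inhomogeneous) Markov chain on [0,oo) with
   transition function Ptr(s,t), via its finite-dimensional distributions *)
Definition is_MC d (Om : measurableType d) (T : finType)
    (P : set Om -> \bar R) (Z : R -> Om -> T) (Ptr : R -> R -> fmat T) : Prop :=
  (forall t x, 0 <= t -> measurable (Z t @^-1` [set x])) /\
  forall (t : R) (x : T) (s : seq (R * T)), 0 <= t ->
    sorted (fun a b : R => a <= b) (t :: map fst s) ->
    P (path_ev Z t x s) = (P [set w | Z t w = x] * (path_prob Ptr t x s)%:E)%E.

Definition hom_trans (T : finType) (Q : fmat T) : R -> R -> fmat T :=
  fun a b => fexp (b - a) Q.

Definition sk (s : nat -> R) (k : nat) : R := if k is 0 then 0 else s k.

(* length of [a,b] /\ (k-th piece of [0,oo)), pieces k = 1..n+1: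
   [s_{k-1}, s_k) for k <= n and [s_n, oo) for k = n+1 *)
Definition piece_len (n : nat) (s : nat -> R) (k : nat) (a b : R) : R :=
  if (k <= n)%N then Num.max 0 (Num.min b (sk s k) - Num.max a (sk s k.-1))
  else Num.max 0 (b - Num.max a (sk s n)).

(* transition function of the time-inhomogeneous chain with piecewise
   constant generator G_t = G_k on [s_{k-1},s_k), G_{n+1} on [s_n,oo):
   the chronologically ordered product of the matrix exponentials *)
Definition inh_trans (T : finType) (n : nat) (G : nat -> fmat T)
    (s : nat -> R) : R -> R -> fmat T :=
  fun a b => foldr (@fmul T) (@fid T)
    [seq fexp (piece_len n s k a b) (G k) | k <- iota 1 n.+1].

Definition Gtilde (E : finType) (n : nat) (G : nat -> fmat E) (q : nat -> R)
    : fmat ('I_n.+1 * E)%type :=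
  fun a b =>
    let k := nat_of_ord a.1 in
    if nat_of_ord b.1 == k then
      G k.+1 a.2 b.2 - (if (k < n)%N then q k.+1 * (a.2 == b.2)%:R else 0)
    else if nat_of_ord b.1 == k.+1 then q k.+1 * (a.2 == b.2)%:R
    else 0.

Definition hit_time (Om : Type) (n : nat) (N : R -> Om -> 'I_n.+1)
    (k : nat) (w : Om) : \bar R :=
  ereal_inf [set t%:E | t in [set t : R | 0 <= t /\ nat_of_ord (N t w) = k]].

Definition cylinder (Om : Type) (E : finType) (Y : R -> Om -> E)
    (u : seq R) (B : set (seq E)) : set Om :=
  [set w | B [seq Y t w | t <- u]].

Definition cyl_sets (Om : Type) (E : finType) (Y : R -> Om -> E) : set (set Om) :=
  [set A | exists (u : seq R) (B : set (seq E)),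
     all (fun t => 0 <= t) u /\ A = cylinder Y u B].

Definition condP (Om : Type) (P : set Om -> \bar R) (C A : set Om) : R :=
  fine (P (A `&` C)) / fine (P C).

End Defs.

(* Main.v *)
Require Import Defs.
From HB Require Import structures.
From mathcomp Require Import all_boot all_order all_algebra.
From mathcomp Require Import all_classical all_reals all_analysis.
From mathcomp Require Import ring lra.
Set Implicit Arguments. Unset Strict Implicit. Unset Printing Implicit Defensive.
Import Order.TTheory GRing.Theory Num.Theory.
Import numFieldNormedType.Exports.
Local Open Scope classical_set_scope.
Local Open Scope ring_scope.

(* By right continuity the infimum defining S_k is attained, and almost surely
   N is nondecreasing; hence for small h the event {s_k < S_k <= s_k + h for
   all k} agrees up to a null set with {N = k-1 at s_k and N = k at s_k + h for
   all k}, which constrains Z at finitely many times.  The generator of Z is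
   block upper triangular, with k-th diagonal block of the semigroup
   exp(-q_{k+1} t) exp(t G_{k+1}) and (k, k+1) block q_{k+1} h I + o(h) at
   time h.  Inserting the constraints on Y between the switches, the probability
   divided by h^n tends to a constant, independent of those constraints, times
   the weight that the chain with generator G_t gives to them.  The constant
   cancels in the conditional probability. *)

(** * Exponential of a finite matrix *)

Section MatrixExponential.
Variables (R : realType) (T : finType).
Implicit Types (A B : fmat R T) (x y z : T) (t : R).

(** Comparison with [K] times the exponential series at [|M| * |t|]; geometric growth is what the
    entries of matrix powers satisfy. *)
Lemma is_cvg_pseries_fact (c : R^nat) (K M t : R) :
  (forall k, `|c k| <= K * M ^+ k) -> cvgn (pseries (fun k => c k / k`!%:R) t).
Proof.
move=> cKM; apply: normed_cvg.
have K0 : 0 <= K by have := cKM 0; rewrite expr0 mulr1; apply: le_trans.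
have cv : cvgn (series (K *: exp_coeff (`|M| * `|t|))).
  exact/is_cvg_seriesZ/is_cvg_series_exp_coeff.
apply: series_le_cvg cv => [k|k|k] /=; first by [].
- by rewrite !fctE /exp_coeff /= mulr_ge0 // divr_ge0 // exprn_ge0 // mulr_ge0.
- rewrite !fctE /exp_coeff /= normrM normrM normrX.
  rewrite (ger0_norm (_ : 0 <= (k`!%:R)^-1 :> R)) ?invr_ge0 //.
  rewrite exprMn mulrAC /GRing.scale /= [X in _ <= X]mulrA ler_wpM2r ?invr_ge0//.
  rewrite mulrA ler_wpM2r ?exprn_ge0 // (le_trans (cKM k)) // ler_wpM2l //.
  by rewrite -normrX ler_norm.
Qed.

(** The entrywise l1 norm: it dominates every absolute row sum, so each further factor [A] costs at
    most one factor [fnorm A]. *)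
Definition fnorm A : R := \sum_(p : T * T) `|A p.1 p.2|.

Lemma fpow_bound A k x y : `|fpow A k x y| <= fnorm A ^+ k.
Proof.
elim: k x y => [|k IH] x y.
  by rewrite /fpow /= /fid expr0; case: eqP; rewrite ?normr1 ?normr0.
rewrite /fpow /= -/(fpow A k) /fmul exprS.
apply: (le_trans (ler_norm_sum _ _ _)).
apply: (@le_trans _ _ (\sum_z `|A x z| * fnorm A ^+ k)).
  by apply: ler_sum => z _; rewrite normrM ler_wpM2l.
rewrite -mulr_suml ler_wpM2r //.
  by rewrite exprn_ge0 // sumr_ge0.
have -> : fnorm A = \sum_x \sum_y `|A x y| by rewrite pair_bigA.
rewrite [leRHS](bigD1 x) //= lerDl.
by rewrite sumr_ge0 // => i _; rewrite sumr_ge0.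
Qed.

Lemma fexpE t A x y :
  fexp t A x y = limn (pseries (fun k => fpow A k x y / k`!%:R) t).
Proof.
rewrite /fexp /pseries; congr (limn (series _)); apply/funext => k /=.
by rewrite mulrAC [RHS]mulrC mulrA.
Qed.

(** Differentiating the exponential series [j] times shifts the powers by [j]; termwise
    differentiation uses [j = 0, 1, 2]. *)
Lemma is_cvg_fpow_shift A x y (j : nat) t :
  cvgn (pseries (fun k => fpow A (j + k)%N x y / k`!%:R) t).
Proof.
apply: (@is_cvg_pseries_fact _ (fnorm A ^+ j) (fnorm A)) => k.
by rewrite -exprD fpow_bound.
Qed.

Lemma pseries_diffs_fact (c : R^nat) :
  pseries_diffs (fun k => c k / k`!%:R) = (fun k => c k.+1 / k`!%:R).
Proof.
apply/funext => k; rewrite /pseries_diffs factS natrM invfM.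
by rewrite mulrCA mulVKf.
Qed.

Lemma fmul_fpowC A k : fmul A (fpow A k) = fmul (fpow A k) A.
Proof.
elim: k => [|k IH]; apply/funext => x; apply/funext => y.
  rewrite /fmul /fpow /= /fid (bigD1 y) //= eqxx mulr1 big1 ?addr0; last first.
    by move=> z zy; rewrite (negbTE zy) mulr0.
  rewrite (bigD1 x) //= eqxx mul1r big1 ?addr0 // => z zx.
  by rewrite eq_sym (negbTE zx) mul0r.
have -> : fpow A k.+1 = fmul A (fpow A k) by [].
rewrite {1}IH {1 3}/fmul.
under eq_bigr do rewrite /fmul mulr_sumr.
rewrite exchange_big /=; apply: eq_bigr => z _.
by rewrite /fmul mulr_suml; apply: eq_bigr => w _; rewrite mulrA.
Qed.

Lemma cvg_fsum (S : Type) (F : set_system S) (I : finType) (P : pred I)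
    (f : I -> S -> R) (l : I -> R) : Filter F ->
  (forall i, P i -> f i h @[h --> F] --> l i) ->
  (\sum_(i | P i) f i h) @[h --> F] --> \sum_(i | P i) l i.
Proof. move=> FF fl; apply: cvg_big => //; exact: add_continuous. Qed.

Lemma pseries_fsum (I : finType) (a : I -> R) (c : I -> R^nat) t :
  (forall i, cvgn (pseries (fun k => c i k / k`!%:R) t)) ->
  limn (pseries (fun k => (\sum_i a i * c i k) / k`!%:R) t) =
  \sum_i a i * limn (pseries (fun k => c i k / k`!%:R) t).
Proof.
move=> cv; apply/cvg_lim => //.
have -> : pseries (fun k => (\sum_i a i * c i k) / k`!%:R) t =
    (fun n => \sum_i a i * pseries (fun k => c i k / k`!%:R) t n).
  apply/funext => m; rewrite /pseries /series /=.
  under [RHS]eq_bigr do rewrite mulr_sumr.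
  rewrite exchange_big /=; apply: eq_bigr => k _.
  by rewrite !mulr_suml; apply: eq_bigr => i _; rewrite !mulrA.
by apply: cvg_fsum => i _; apply: cvgMl_tmp; exact: cv.
Qed.

Lemma is_derive_fexp_series A x y t :
  is_derive t 1 (fun t => fexp t A x y)
    (limn (pseries (fun k => fpow A k.+1 x y / k`!%:R) t)).
Proof.
rewrite (_ : (fun t => _) =
    (fun t => limn (pseries (fun k => fpow A k x y / k`!%:R) t))); last first.
  by apply/funext => u; rewrite fexpE.
rewrite -(pseries_diffs_fact (fun k => fpow A k x y)).
(* The radius [|t| + 1] is just a number exceeding [|t|]. *)
apply: (@pseries_snd_diffs _ _ (`|t| + 1)); rewrite ?(pseries_diffs_fact (fun k => fpow A k x y)).
- exact: (@is_cvg_fpow_shift A x y 0).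
- exact: (@is_cvg_fpow_shift A x y 1).
- rewrite (pseries_diffs_fact (fun k => fpow A k.+1 x y)).
  exact: (@is_cvg_fpow_shift A x y 2).
- by rewrite [ltRHS]ger0_norm ?addr_ge0// ltrDl.
Qed.

Lemma is_cvg_fpow A x y t : cvgn (pseries (fun k => fpow A k x y / k`!%:R) t).
Proof. exact: (@is_cvg_fpow_shift A x y 0). Qed.

Lemma is_derive_fexpl A x y t :
  is_derive t 1 (fun t => fexp t A x y) (fmul A (fexp t A) x y).
Proof.
apply: is_derive_eq (is_derive_fexp_series A x y t) _.
rewrite (pseries_fsum (fun z => A x z) (c := fun z k => fpow A k z y)).
  by apply: eq_bigr => z _; rewrite fexpE.
by move=> z; exact: is_cvg_fpow.
Qed.

(** Since [A] commutes with its powers, the factor also comes out on the right. The product rule for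
    e^{tA} e^{(c-t)B} uses both forms, so that [A] and [B] meet in the middle. *)
Lemma is_derive_fexpr A x y t :
  is_derive t 1 (fun t => fexp t A x y) (fmul (fexp t A) A x y).
Proof.
apply: is_derive_eq (is_derive_fexp_series A x y t) _.
rewrite (_ : (fun k => _) =
    (fun k => (\sum_z A z y * fpow A k x z) / k`!%:R)); last first.
  apply/funext => k; congr (_ / _).
  rewrite (_ : fpow A k.+1 = fmul A (fpow A k)) // fmul_fpowC.
  by apply: eq_bigr => z _; rewrite mulrC.
rewrite (pseries_fsum (fun z => A z y) (c := fun z k => fpow A k x z)).
  by apply: eq_bigr => z _; rewrite fexpE mulrC.
by move=> z; exact: is_cvg_fpow.
Qed.

Lemma fexp0 A : fexp 0 A = @fid R T.
Proof.
apply/funext => x; apply/funext => y; rewrite fexpE; apply/lim_near_cst => //.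
near=> m; rewrite /pseries /series /= -[m]prednK; last by near: m.
rewrite big_nat_recl //= big1 ?addr0; last first.
  by move=> i _; rewrite exprS mul0r mulr0.
by rewrite expr0 mulr1 divr1.
Unshelve. all: by end_near. Qed.

Lemma continuous_fexp A x y : continuous (fun t => fexp t A x y).
Proof.
move=> t; apply/differentiable_continuous/derivable1_diffP.
by have [] := is_derive_fexpl A x y t.
Qed.

Lemma is_derive_fsum (I : finType) (f : I -> R -> R) (df : I -> R) t :
  (forall i, is_derive t 1 (f i) (df i)) ->
  is_derive t 1 (fun t => \sum_i f i t) (\sum_i df i).
Proof.
move=> fdf; rewrite (_ : (fun t => _) = \sum_i f i); last first.
  by apply/funext => u; rewrite fct_sumE.
elim/big_ind2: _ => [|f1 d1 f2 d2 h1 h2|i _]; [exact: is_derive_cst|exact: is_deriveD|exact: fdf].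
Qed.

Lemma fmul_fid A : fmul A (@fid R T) = A.
Proof.
apply/funext => x; apply/funext => y; rewrite /fmul /fid (bigD1 y) //= eqxx.
by rewrite mulr1 big1 ?addr0 // => z /negbTE ->; rewrite mulr0.
Qed.

Lemma fid_fmul A : fmul (@fid R T) A = A.
Proof.
apply/funext => x; apply/funext => y; rewrite /fmul /fid (bigD1 x) //= eqxx.
by rewrite mul1r big1 ?addr0 // => z; rewrite eq_sym => /negbTE ->; rewrite mul0r.
Qed.

Lemma fmulA A B (C : fmat R T) : fmul A (fmul B C) = fmul (fmul A B) C.
Proof.
apply/funext => x; apply/funext => y; rewrite /fmul.
under eq_bigr do rewrite mulr_sumr.
rewrite exchange_big /=; apply: eq_bigr => z _.
by rewrite mulr_suml; apply: eq_bigr => w _; rewrite mulrA.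
Qed.

(* The left-hand side does not depend on [t]: its derivative vanishes. *)
Lemma fexp_shift_mul A B (q c t : R) x y :
  (forall u v, B u v = A u v - q * (u == v)%:R) ->
  expR (- (q * t)) * fmul (fexp t A) (fexp (c - t) B) x y = fexp c B x y.
Proof.
move=> BE.
pose h t := \sum_z (expR (- (q * t)) * fexp t A x z) * fexp (c - t) B z y.
have hE u : expR (- (q * u)) * fmul (fexp u A) (fexp (c - u) B) x y = h u.
  by rewrite /h /fmul mulr_sumr; apply: eq_bigr => z _; rewrite mulrA.
rewrite hE (_ : fexp c B x y = h (0 : R)); last first.
  by rewrite -(hE 0) mulr0 oppr0 expR0 mul1r addr0 fexp0 fid_fmul.
apply: is_derive_0_is_cst => u.
have dexp : is_derive u 1 (fun t => expR (- (q * t))) (- q * expR (- (q * u))).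
  have d1 : is_derive u 1 (fun t : R => - q * t) (- q).
    by apply: is_derive_eq; rewrite /GRing.scale /= mulr1.
  have := is_derive1_comp (is_derive_expR (- q * u)) d1.
  by rewrite mulrC -mulNr; congr is_derive; apply/funext => v /=; rewrite mulNr.
have dB z : is_derive u 1 (fun t => fexp (c - t) B z y)
    (- fmul B (fexp (c - u) B) z y).
  have d1 : is_derive u 1 (fun t : R => c - t) (- 1).
    by apply: is_derive_eq; rewrite add0r mul1r.
  have := @is_derive1_comp _ (fun t => fexp t B z y) (fun t => c - t) u _ _
    (is_derive_fexpl B z y (c - u)) d1.
  by rewrite mulrN mulr1.
(* The product rule gives e^{-qu} e^{uA} (A - qI - B) e^{(c-u)B}, which vanishes because B = A -
   qI. *)
apply: (is_derive_eq (is_derive_fsum (fun z =>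
  is_deriveM (is_deriveM dexp (is_derive_fexpr A x z u)) (dB z)))).
rewrite big_split /= [X in X + _](_ : _ = - (expR (- (q * u)) *
    fmul (fexp u A) (fmul B (fexp (c - u) B)) x y)); last first.
  rewrite /fmul mulr_sumr -sumrN; apply: eq_bigr => z _.
  by rewrite /GRing.scale /= mulrN mulrA.
rewrite fmulA addrC; apply/eqP; rewrite subr_eq0; apply/eqP.
rewrite /fmul mulr_sumr; apply: eq_bigr => z _.
rewrite -/(fmul (fexp u A) A x z) -/(fmul (fexp u A) B x z).
have -> : fmul (fexp u A) B x z = fmul (fexp u A) A x z - q * fexp u A x z.
  rewrite -{3}(fmul_fid (fexp u A)) /fmul mulr_sumr -sumrB.
  by apply: eq_bigr => w _; rewrite BE /fid; ring.
by rewrite /GRing.scale /=; ring.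
Qed.

(** The constancy above with [q = 0] and [B = A], read at time [a] with total time [a + b]. *)
Lemma fexpD A (a b : R) : fexp (a + b) A = fmul (fexp a A) (fexp b A).
Proof.
apply/funext => x; apply/funext => y.
have A0 u v : A u v = A u v - 0 * (u == v)%:R by rewrite mul0r subr0.
rewrite -(fexp_shift_mul (a + b) a _ _ A0).
by rewrite mul0r oppr0 expR0 mul1r [a + b]addrC addrK.
Qed.

(** The constancy above read at [t = c], where the second exponential is the identity. *)
Lemma fexp_shift A B (q c : R) x y :
  (forall u v, B u v = A u v - q * (u == v)%:R) ->
  fexp c B x y = expR (- (q * c)) * fexp c A x y.
Proof.
by move=> BE; rewrite -(fexp_shift_mul c c _ _ BE) subrr fexp0 fmul_fid.
Qed.

(** The derivative of the row sum is a combination of the row sums of [A], hence zero; at time 0 the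
    row sum is 1. *)
Lemma fexp_row_sum A t x :
  (forall x, \sum_y A x y = 0) -> \sum_y fexp t A x y = 1.
Proof.
move=> A0; pose f u := \sum_y fexp u A x y.
have -> : \sum_y fexp t A x y = f 0.
  apply: (@is_derive_0_is_cst _ f) => u.
  apply: (is_derive_eq (is_derive_fsum (fun y => is_derive_fexpr A x y u))).
  rewrite /fmul exchange_big big1 //= => z _.
  by rewrite -mulr_sumr A0 mulr0.
rewrite /f fexp0 (bigD1 x) //= /fid eqxx big1 ?addr0 // => y.
by rewrite eq_sym => /negbTE ->.
Qed.

(** Off the diagonal the exponential vanishes at 0, so the ratio is a difference quotient at 0. *)
Lemma fexp_slope A x y : x != y ->
  fexp h A x y / h @[h --> 0^'+] --> A x y.
Proof.
move=> xy; apply: cvg_dnbhs_at_right.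
have [d1 d2] := is_derive_fexpl A x y 0.
have {d2} : 'D_1 (fun t => fexp t A x y) 0 = A x y by rewrite d2 fexp0 fmul_fid.
move=> <-; apply: cvg_trans d1; apply: near_eq_cvg; near=> h.
rewrite /= addr0 fexp0 /fid (negbTE xy) subr0 [h%:A]mulr1 /GRing.scale /=.
by rewrite mulrC.
Unshelve. all: by end_near. Qed.

End MatrixExponential.

(** * Events depending on finitely many times *)

Section FiniteDimensional.
Variables (R : realType) (T : finType).
Implicit Types (L : seq (R * pred T)) (t u : R) (x y : T).

(** Each time carries a set of states instead of a single state: a switch constrains the level and
    leaves the coordinate in [E] free. *)
Fixpoint wprob (Ptr : R -> R -> fmat R T) t x L : R :=
  if L is (u, f) :: L' then \sum_(y | f y) Ptr t u x y * wprob Ptr u y L'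
  else 1.

Definition wev (Om : Type) (Z : R -> Om -> T) L : set Om :=
  [set w | all (fun p => p.2 (Z p.1 w)) L].

Definition nonneg_times (A : Type) (L : seq (R * A)) := all (fun p => 0 <= p.1) L.

Definition pin (s : seq (R * T)) : seq (R * pred T) :=
  [seq (p.1, pred1 p.2 : pred T) | p <- s].

Lemma wev_nil (Om : Type) (Z : R -> Om -> T) : wev Z [::] = setT.
Proof. by apply/seteqP; split. Qed.

Lemma wev_cons (Om : Type) (Z : R -> Om -> T) u (f : pred T) L :
  wev Z ((u, f) :: L) = [set w | f (Z u w)] `&` wev Z L.
Proof. by apply/seteqP; split=> w /=; [move/andP|case=> *; apply/andP]. Qed.

Lemma wprob_pred1 (Ptr : R -> R -> fmat R T) t x (s : seq (R * T)) :
  wprob Ptr t x (pin s) = path_prob Ptr t x s.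
Proof.
elim: s t x => [//|[u y] s IH] t x /=.
by rewrite (big_pred1 y) // IH.
Qed.

Lemma path_evE (Om : Type) (Z : R -> Om -> T) t x (s : seq (R * T)) :
  path_ev Z t x s = wev Z (pin ((t, x) :: s)).
Proof.
elim: s t x => [|[u y] s IH] t x /=; rewrite wev_cons.
  by rewrite wev_nil setIT; apply/seteqP; split=> w /= /eqP.
by rewrite IH; congr (_ `&` _); apply/seteqP; split=> w /= /eqP.
Qed.

Section Probability.
Context d (Om : measurableType d) (P : probability Om R).

Lemma measurable_fibers (S : finType) (X : Om -> S) (B : set S) :
  (forall v : S, measurable (X @^-1` [set v])) -> measurable (X @^-1` B).
Proof.
move=> mX; rewrite (_ : _ @^-1` _ = \bigcup_(v in B) (X @^-1` [set v])).
  by apply: fin_bigcup_measurable => //; exact: finite_finset.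
apply/seteqP; split=> [w Bw|w [v Bv /= Xw]]; first by exists (X w).
by rewrite /preimage /= Xw.
Qed.

Lemma probability_fibers (S : finType) (X : Om -> S) (A : set Om) :
  (forall v : S, measurable (X @^-1` [set v])) -> measurable A ->
  P A = (\sum_(v : S) P (A `&` X @^-1` [set v]))%E.
Proof.
move=> mX mA.
rewrite fsbig_seq; last exact: index_enum_uniq.
rewrite -measure_fin_bigcup.
- congr (P _); apply/seteqP; split=> [w Aw|w [x _ []]] //.
  by exists (X w) => //=; rewrite mem_index_enum.
- exact: finite_seq.
- by move=> x y _ _ [w [[_ /= <-] [_ /= <-]]].
- by move=> x _; exact: measurableI.
Qed.

Variables (Z : R -> Om -> T).
Hypothesis mZ : forall t x, 0 <= t -> measurable (Z t @^-1` [set x]).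

Lemma measurable_wev L : nonneg_times L -> measurable (wev Z L).
Proof.
elim: L => [|[u f] L IH] /=; first by rewrite wev_nil.
move=> /andP[u0 L0]; rewrite wev_cons; apply: measurableI; last exact: IH.
by apply: (@measurable_fibers _ (Z u) [set x | f x]) => x; exact: mZ.
Qed.

Lemma path_nonneg t L : 0 <= t -> path (fun a b => a <= b) t (map fst L) ->
  nonneg_times L.
Proof.
elim: L t => [//|[u f] L IH] t t0 /= /andP[tu uL].
by rewrite (le_trans t0 tu) (IH u) // (le_trans t0 tu).
Qed.

Lemma measurable_path_ev t x s : 0 <= t ->
  path (fun a b => a <= b) t (map fst s) -> measurable (path_ev Z t x s).
Proof.
move=> t0 ts; rewrite path_evE; apply: measurable_wev => /=; rewrite t0 /=.
by apply: (path_nonneg t0); rewrite -map_comp.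
Qed.

Lemma path_ev_rcons t x s u y :
  path_ev Z t x (rcons s (u, y)) = path_ev Z t x s `&` (Z u @^-1` [set y]).
Proof. by elim: s t x => [//|[v z] s IH] t x /=; rewrite IH setIA. Qed.

Lemma path_prob_rcons (Ptr : R -> R -> fmat R T) t x (s : seq (R * T)) u y :
  path_prob Ptr t x (rcons s (u, y)) = path_prob Ptr t x s *
    Ptr (last t (map fst s)) u (last x (map snd s)) y.
Proof.
elim: s t x => [|[v z] s IH] t x /=; first by rewrite mulr1 mul1r.
by rewrite IH mulrA.
Qed.

(** The Markov property speaks of single states. Splitting by the value at the next time of [L]
    moves that time to the end of the pinned path [s], until [L] is exhausted. *)
Lemma MC_path_wprob Ptr t x s L : is_MC P Z Ptr -> 0 <= t ->
  path (fun a b => a <= b) t (map fst s ++ map fst L) ->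
  P (path_ev Z t x s `&` wev Z L) = (P [set w | Z t w = x] *
    (path_prob Ptr t x s *
     wprob Ptr (last t (map fst s)) (last x (map snd s)) L)%:E)%E.
Proof.
move=> MC t0; elim: L s => [|[u f] L IH] s ts.
  rewrite wev_nil setIT mulr1; move: ts; rewrite cats0; exact: MC.2.
have u0 : 0 <= u.
  have : path (fun a b => a <= b) t (rcons (map fst s) u).
    by move: ts; rewrite -cat_rcons cat_path => /andP[].
  move=> /(order_path_min le_trans) /allP /(_ u).
  by rewrite mem_rcons mem_head => /(_ isT); exact: le_trans.
have L0 : nonneg_times L.
  by apply: (path_nonneg u0); move: ts; rewrite cat_path /= => /and3P[].
have s0 : path (fun a b => a <= b) t (map fst s).
  by move: ts; rewrite cat_path => /andP[].
rewrite (@probability_fibers _ (Z u)); last first.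
- apply: measurableI; first exact: measurable_path_ev.
  by apply: measurable_wev; rewrite /= u0.
- by move=> y; exact: mZ.
have -> : P [set w | Z t w = x] = (fine (P [set w | Z t w = x]))%:E.
  by rewrite fineK // fin_num_measure //; exact: mZ.
rewrite -EFinM /= [in RHS]big_mkcond /= !mulr_sumr -sumEFin; apply: eq_bigr => y _.
(* An admissible value extends the pinned path; any other value makes the event empty. *)
have [fy|fy] := boolP (f y).
  have -> : path_ev Z t x s `&` wev Z ((u, f) :: L) `&` Z u @^-1` [set y] =
      path_ev Z t x (rcons s (u, y)) `&` wev Z L.
    rewrite path_ev_rcons wev_cons; apply/seteqP; split=> [w [[? []]] //|].
    by move=> w [[? /= Zy] ?]; rewrite Zy.
  rewrite IH; last by rewrite map_rcons cat_rcons.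
  rewrite path_prob_rcons !map_rcons !last_rcons /= !mulrA.
  rewrite -[in LHS](@fineK _ (P _)) ?fin_num_measure //; last exact: mZ.
  by rewrite -EFinM !mulrA.
rewrite (_ : _ `&` _ = set0) ?measure0 ?mulr0 //.
rewrite wev_cons; apply/seteqP; split=> // w [[_ [/= fz _]] /= Zy].
by move: fz; rewrite Zy (negbTE fy).
Qed.

Lemma MC_wprob Ptr t x L : is_MC P Z Ptr -> 0 <= t ->
  path (fun a b => a <= b) t (map fst L) ->
  P ([set w | Z t w = x] `&` wev Z L) =
    (P [set w | Z t w = x] * (wprob Ptr t x L)%:E)%E.
Proof. by move=> MC t0 tL; rewrite (@MC_path_wprob Ptr t x [::]) //= mul1r. Qed.

End Probability.

Section ChapmanKolmogorov.
Variable Ptr : R -> R -> fmat R T.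
Hypothesis CK : forall a b c, 0 <= a -> a <= b -> b <= c ->
  fmul (Ptr a b) (Ptr b c) = Ptr a c.
Hypothesis stoch : forall a b x, 0 <= a -> a <= b -> \sum_y Ptr a b x y = 1.

(** An unconstrained time [b] may be inserted before all constraints: Chapman-Kolmogorov if a
    constraint follows, row sums equal to 1 if none does. *)
Lemma wprob_CK a b x L : 0 <= a -> a <= b ->
  path (fun a b => a <= b) b (map fst L) ->
  wprob Ptr a x L = \sum_z Ptr a b x z * wprob Ptr b z L.
Proof.
move=> a0 ab; case: L => [|[u f] L] /= bL.
  by under eq_bigr do rewrite mulr1; rewrite stoch.
have bu : b <= u by case/andP: bL.
under [RHS]eq_bigr do rewrite mulr_sumr.
rewrite exchange_big /=; apply: eq_bigr => y _.
rewrite -(CK a0 ab bu) /fmul mulr_suml.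
by apply: eq_bigr => z _; rewrite mulrA.
Qed.

End ChapmanKolmogorov.

Lemma cylinder_wev (Om : Type) (Z : R -> Om -> T) L :
  wev Z L = cylinder Z (map fst L) [set ys | all (fun p => p.1.2 p.2) (zip L ys)].
Proof.
apply/seteqP; split=> w /=; rewrite /cylinder /wev /=.
  by elim: L => //= p L IH /andP[-> /IH].
by elim: L => //= p L IH /andP[-> /IH].
Qed.

(* Sorting goes through indices because the universe of [R * pred T] is too
   large for [sort]. *)
Definition sort_times L : seq (R * pred T) :=
  let p0 := (0, predT : pred T) in
  [seq nth p0 L k | k <- sort (fun j k => (nth p0 L j).1 <= (nth p0 L k).1)
                              (iota 0 (size L))].

Lemma all_sort_times (p : pred (R * pred T)) L : all p (sort_times L) = all p L.
Proof. by rewrite all_map all_sort -all_map -/(mkseq _ _) mkseq_nth. Qed.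

Lemma wev_sort_times (Om : Type) (Z : R -> Om -> T) L :
  wev Z (sort_times L) = wev Z L.
Proof. by apply/seteqP; split=> w /=; rewrite /wev /= all_sort_times. Qed.

Lemma sorted_sort_times L :
  sorted (fun a b => a <= b) (map fst (sort_times L)).
Proof.
rewrite -map_comp sorted_map; apply: sort_sorted => j k /=; exact: le_total.
Qed.

(** The values at the times [u] live in a finite type, so that an arbitrary [B] splits into finitely
    many fibers. *)
Definition tuple_at (Om : Type) (X : R -> Om -> T) (u : seq R) (w : Om)
  : (size u).-tuple T := [tuple of [seq X t w | t <- in_tuple u]].

Definition pin_tuple (u : seq R) (ys : seq T) := pin (zip u ys).

Lemma tuple_at_fiber (Om : Type) (X : R -> Om -> T) (u : seq R)
    (ys : (size u).-tuple T) :
  tuple_at X u @^-1` [set ys] = wev X (pin_tuple u ys).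
Proof.
apply/seteqP; split=> [w /= <-|w /= Xw].
  rewrite /wev /pin_tuple /pin /=.
  by elim: u {ys} => //= t u ->; rewrite eqxx.
apply/val_inj => /=; case: ys Xw => ys /=.
elim: u ys => [|t u IH] [|y ys] //= /eqP [/eqP sz].
by rewrite /wev /= => /andP[/eqP -> /IH ->].
Qed.

Lemma nonneg_times_pin (u : seq R) (ys : seq T) : all (fun t => 0 <= t) u ->
  nonneg_times (pin_tuple u ys).
Proof.
rewrite /pin_tuple /pin /nonneg_times.
by elim: u ys => [|t u IH] [|y ys] //= /andP[-> u0]; exact: IH.
Qed.

(** Reduces an arbitrary cylinder to events pinning one state at each time. The event [C] leaves
    room for conditioning on the initial state. *)
Lemma cylinder_prob (d : measure_display) (Om : measurableType d)
    (P : probability Om R) (X : R -> Om -> T) (C : set Om) (u : seq R)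
    (B : set (seq T)) :
  (forall t x, 0 <= t -> measurable (X t @^-1` [set x])) -> measurable C ->
  all (fun t => 0 <= t) u ->
  fine (P (cylinder X u B `&` C)) =
    \sum_(ys : (size u).-tuple T | `[< B ys >])
      fine (P (C `&` wev X (pin_tuple u ys))).
Proof.
move=> mX mC u0.
have mF (ys : (size u).-tuple T) : measurable (tuple_at X u @^-1` [set ys]).
  by rewrite tuple_at_fiber; apply: measurable_wev => //; exact: nonneg_times_pin.
have mA : measurable (cylinder X u B).
  exact: (@measurable_fibers _ _ _ (tuple_at X u) [set ys | B ys]).
rewrite (probability_fibers P mF (measurableI _ _ mA mC)) -sum_fine; last first.
  by move=> ys _; rewrite fin_num_measure //; apply/measurableI/mF/measurableI.
rewrite [RHS]big_mkcond /=; apply: eq_bigr => ys _.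
case: asboolP => [Bys|nBys].
  congr (fine (P _)); rewrite -tuple_at_fiber; apply/seteqP; split=> w.
    by move=> [[_ Cw] Fw].
  by move=> [Cw Fw]; do 2!split=> //; rewrite /cylinder /=; rewrite -Fw in Bys.
rewrite (_ : _ `&` _ = set0) ?measure0 //; apply/seteqP; split=> // w [[Bw _] Fw].
by apply: nBys; rewrite -Fw.
Qed.

End FiniteDimensional.

(** * Piecewise constant generators *)

Section PiecewiseGenerator.
Variables (R : realType) (E : finType) (n : nat) (G : nat -> fmat R E).
Variable s : nat -> R.
Hypothesis hG : forall k, (1 <= k <= n.+1)%N -> is_generator (G k).
Hypothesis hs1 : (0 < n)%N -> 0 < s 1%N.
Hypothesis hs : forall k, (1 <= k < n)%N -> s k < s k.+1.

Lemma sk_ltS k : (k < n)%N -> sk s k < s k.+1.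
Proof. by case: k => [|k] kn /=; [exact: hs1|exact: hs]. Qed.

Lemma sk_le k l : (k <= l)%N -> (l <= n)%N -> sk s k <= sk s l.
Proof.
elim: l => [|l IH]; first by rewrite leqn0 => /eqP ->.
rewrite leq_eqVlt => /orP[/eqP -> //|kl ln].
by rewrite (le_trans (IH kl (ltnW ln))) // ltW // sk_ltS.
Qed.

Ltac case_max := repeat
  match goal with
  | |- context[Order.max ?x ?y] => case: (leP x y)
  | |- context[Order.min ?x ?y] => case: (leP x y)
  end.

(** The projection of [t] onto the closure of the [k]-th piece. Lengths become differences of
    projections, and their additivity telescopes. *)
Definition clamp k t :=
  if (k <= n)%N then Num.max (sk s k.-1) (Num.min t (sk s k))
  else Num.max (sk s n) t.

Lemma piece_len_clamp k a b : (0 < k)%N -> a <= b ->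
  piece_len n s k a b = clamp k b - clamp k a.
Proof.
move=> k0 ab; rewrite /piece_len /clamp; case: ifP => kn'.
  have := sk_ltS (_ : (k.-1 < n)%N); rewrite prednK // => /(_ kn').
  rewrite (_ : s k = sk s k); last by case: k k0 {kn'}.
  by move=> sS; case_max; move=> *; lra.
by case_max; move=> *; lra.
Qed.

Lemma piece_lenD k a b c : (0 < k)%N -> a <= b -> b <= c ->
  piece_len n s k a b + piece_len n s k b c = piece_len n s k a c.
Proof.
by move=> k0 ab bc; rewrite !piece_len_clamp ?(le_trans ab bc) //; ring.
Qed.

Lemma piece_len_left k a b : (k <= n)%N -> sk s k <= a -> piece_len n s k a b = 0.
Proof. by move=> kn ka; rewrite /piece_len kn; case_max; move=> *; lra. Qed.

Lemma piece_len_right k l a b : (k < l)%N -> (k <= n)%N -> (l <= n.+1)%N ->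
  b <= sk s k -> piece_len n s l a b = 0.
Proof.
move=> kl kn ln bk; rewrite /piece_len; case: ifP => ln'.
  have kl' : (k <= l.-1)%N by rewrite -ltnS prednK // (leq_ltn_trans _ kl).
  have := sk_le kl' (leq_trans (leq_pred _) ln') => ?; case_max; move=> *; lra.
have := sk_le kn (leqnn n) => ?; by case_max; move=> *; lra.
Qed.

Lemma piece_len_mid k a b : (k <= n)%N -> sk s k <= a -> a <= b ->
  ((k < n)%N -> b <= s k.+1) -> piece_len n s k.+1 a b = b - a.
Proof.
move=> kn ka ab bk; rewrite /piece_len /=; case: ifP => kn'.
  by have {}bk := bk kn'; case_max; move=> *; lra.
have <- : k = n by apply/eqP; rewrite eqn_leq kn leqNgt kn'.
by case_max; move=> *; lra.
Qed.

(** The product defining [inh_trans], over any list of pieces, so that induction on the list is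
    possible. *)
Definition piece_prod (r : seq nat) (a b : R) : fmat R E :=
  foldr (@fmul R E) (@fid R E) [seq fexp (piece_len n s k a b) (G k) | k <- r].

Lemma piece_prod_id (r : seq nat) a b :
  (forall k, k \in r -> piece_len n s k a b = 0) -> piece_prod r a b = @fid R E.
Proof.
rewrite /piece_prod; elim: r => //= k r IH r0.
rewrite r0 ?mem_head // fexp0 fid_fmul IH // => l lr.
by rewrite r0 // inE lr orbT.
Qed.

(** The generators need not commute, but no two factors have to be exchanged: either piece [m] ends
    by time [b], and its factor over [b,c] is the identity, or all later factors over [a,b] are. The
    condition [m + j = n.+2] says that the list runs from [m] to the last piece. *)
Lemma piece_prodM m j a b c : (0 < m)%N -> (m + j = n.+2)%N ->
  a <= b -> b <= c ->
  fmul (piece_prod (iota m j) a b) (piece_prod (iota m j) b c) =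
  piece_prod (iota m j) a c.
Proof.
move=> m0 mj ab bc; elim: j m m0 mj => [|j IH] m m0 mj.
  by rewrite /piece_prod /= fmul_fid.
have mn : (m <= n.+1)%N by rewrite -ltnS -mj addnS ltnS leq_addr.
have IHm : fmul (piece_prod (iota m.+1 j) a b) (piece_prod (iota m.+1 j) b c) =
    piece_prod (iota m.+1 j) a c by apply: IH; rewrite // addSnnS.
have lenD : piece_len n s m a b + piece_len n s m b c = piece_len n s m a c.
  exact: piece_lenD.
rewrite {1 2 3}/piece_prod /= -!/(piece_prod _ _ _) fmulA -(fmulA _ _ (fexp _ _)).
have [smb|bsm] := boolP ((m <= n)%N && (sk s m <= b)).
  have b0 : piece_len n s m b c = 0 by case/andP: smb => *; apply: piece_len_left.
  by rewrite -lenD b0 addr0 fexp0 fmul_fid -fmulA IHm.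
have ab0 : piece_prod (iota m.+1 j) a b = @fid R E.
  apply: piece_prod_id => l; rewrite mem_iota addSnnS mj => /andP[ml ln].
  have mn' : (m <= n)%N by rewrite -ltnS (leq_trans ml) // -ltnS.
  by apply: (@piece_len_right m) => //; move: bsm; rewrite mn' /= -ltNge => /ltW.
by rewrite -IHm ab0 !fid_fmul -fexpD lenD.
Qed.

Lemma inh_trans_piece_prod a b :
  inh_trans n G s a b = piece_prod (iota 1 n.+1) a b.
Proof. by []. Qed.

Lemma inh_trans_CK a b c : 0 <= a -> a <= b -> b <= c ->
  fmul (inh_trans n G s a b) (inh_trans n G s b c) = inh_trans n G s a c.
Proof. by move=> _ ab bc; apply: (@piece_prodM 1 n.+1). Qed.

Lemma inh_trans_stoch a b x : 0 <= a -> a <= b ->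
  \sum_y inh_trans n G s a b x y = 1.
Proof.
move=> _ _; rewrite inh_trans_piece_prod.
have : forall k, k \in iota 1 n.+1 -> is_generator (G k).
  by move=> k; rewrite mem_iota; exact: hG.
rewrite /piece_prod; elim: (iota 1 n.+1) x => [|k r IH] x gen /=.
  by rewrite (bigD1 x) //= /fid eqxx big1 ?addr0 // => y; rewrite eq_sym => /negbTE ->.
rewrite /fmul exchange_big /=.
rewrite -[RHS](fexp_row_sum (piece_len n s k a b) x (gen k (mem_head _ _)).2).
apply: eq_bigr => z _; rewrite -mulr_sumr IH ?mulr1 // => l lr.
by apply: gen; rewrite inE lr orbT.
Qed.

(** Only piece [k.+1] meets [a,b] in positive length. Both endpoints may be switching times, since
    single points have length zero. *)
Lemma inh_transE k a b : (k <= n)%N -> sk s k <= a -> a <= b ->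
  ((k < n)%N -> b <= s k.+1) -> inh_trans n G s a b = fexp (b - a) (G k.+1).
Proof.
move=> kn ka ab bk; rewrite inh_trans_piece_prod.
have -> : iota 1 n.+1 = iota 1 k ++ k.+1 :: iota k.+2 (n - k).
  by rewrite -(subnKC kn) -addnS iotaD add1n addKn.
rewrite /piece_prod map_cat foldr_cat /= -/(piece_prod (iota k.+2 (n - k)) a b).
rewrite piece_len_mid // piece_prod_id; last first.
  move=> l; rewrite mem_iota => /andP[kl]; rewrite addSn addSn subnKC // => ln.
  have kn' : (k < n)%N by rewrite -ltnS -ltnS (leq_ltn_trans kl).
  by apply: (@piece_len_right k.+1) => //; apply: bk.
rewrite fmul_fid.
have : forall l, l \in iota 1 k -> piece_len n s l a b = 0.
  move=> l; rewrite mem_iota => /andP[l0 lk].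
  have ln : (l <= n)%N by rewrite (leq_trans _ kn) // -ltnS -add1n.
  by apply: piece_len_left => //; rewrite (le_trans _ ka) // sk_le.
elim: (iota 1 k) => //= l r IH r0; rewrite r0 ?mem_head // fexp0 fid_fmul.
by apply: IH => m mr; apply: r0; rewrite inE mr orbT.
Qed.

Lemma wprob_inh_CK a b x (L : seq (R * pred E)) : 0 <= a -> a <= b ->
  path (fun a b => a <= b) b (map fst L) ->
  wprob (inh_trans n G s) a x L =
    \sum_z inh_trans n G s a b x z * wprob (inh_trans n G s) b z L.
Proof. exact: wprob_CK inh_trans_CK inh_trans_stoch _ _ _ _. Qed.

End PiecewiseGenerator.

(** * The block generator and its small time asymptotics *)

Section BlockGenerator.
Variables (R : realType) (E : finType) (n : nat) (G : nat -> fmat R E).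
Variable q : nat -> R.
Let T : finType := ('I_n.+1 * E)%type.
Let Gt : fmat R T := @Gtilde R E n G q.

(** The rate of leaving level [k]; the last level is never left. *)
Definition rate k := if (k < n)%N then q k.+1 else 0.

Definition killed k : fmat R E := fun x y => G k.+1 x y - rate k * (x == y)%:R.

Lemma Gtilde_lower (a b : T) : (b.1 < a.1)%N -> Gt a b = 0.
Proof.
move=> ba; rewrite /Gt /Gtilde ltn_eqF // ifN //.
by rewrite neq_ltn ltnS (ltnW ba).
Qed.

Lemma Gtilde_diag (a b : T) : b.1 = a.1 -> Gt a b = killed a.1 a.2 b.2.
Proof.
by move=> ba; rewrite /Gt /Gtilde ba eqxx /killed /rate; case: ifP; rewrite ?mul0r.
Qed.

Lemma Gtilde_next (a b : T) : b.1 = a.1.+1 :> nat ->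
  Gt a b = q a.1.+1 * (a.2 == b.2)%:R.
Proof. by move=> ba; rewrite /Gt /Gtilde ba eqxx gtn_eqF. Qed.

Lemma sum_level (l : 'I_n.+1) (F : T -> R) :
  (forall z, z.1 != l -> F z = 0) -> \sum_z F z = \sum_y F (l, y).
Proof.
move=> F0; transitivity (\sum_k \sum_y F (k, y)).
  by rewrite pair_bigA; apply: eq_bigr => -[].
rewrite (bigD1 l) //= [X in _ + X]big1 ?addr0 // => k kl.
by rewrite big1 // => y _; exact: F0.
Qed.

Lemma fpow_Gtilde_lower j (a b : T) : (b.1 < a.1)%N -> fpow Gt j a b = 0.
Proof.
elim: j a => [|j IH] a ba.
  rewrite /fpow /= /fid; case: eqP => // ab; by rewrite ab ltnn in ba.
rewrite /fpow /= -/(fpow Gt j) /fmul big1 // => z _.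
have [za|az] := ltnP z.1 a.1; first by rewrite Gtilde_lower ?mul0r.
by rewrite IH ?mulr0 // (leq_trans ba).
Qed.

(** An intermediate level below [l] kills the first factor and one above [l] kills the second, so
    only level [l] contributes. *)
Lemma fpow_Gtilde_diag j (l : 'I_n.+1) x y :
  fpow Gt j (l, x) (l, y) = fpow (killed l) j x y.
Proof.
elim: j x => [|j IH] x.
  by rewrite /fpow /= /fid; congr (nat_of_bool _)%:R; rewrite xpair_eqE eqxx.
rewrite /fpow /= -/(fpow Gt j) -/(fpow (killed l) j) /fmul (sum_level (l := l)).
  by apply: eq_bigr => z _; rewrite IH Gtilde_diag.
move=> z; rewrite -val_eqE neq_ltn => /orP[zl|lz].
  by rewrite Gtilde_lower ?mul0r.
by rewrite fpow_Gtilde_lower ?mulr0.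
Qed.

Lemma fexp_Gtilde_lower t (a b : T) : (b.1 < a.1)%N -> fexp t Gt a b = 0.
Proof.
move=> ba; rewrite /fexp (_ : (fun k => _) = fun=> 0); last first.
  by apply/funext => k; rewrite fpow_Gtilde_lower ?mulr0.
rewrite (_ : series _ = cst 0); first exact: lim_cst.
by apply/funext => m; rewrite /series /= big1.
Qed.

Lemma fexp_Gtilde_diag t (l : 'I_n.+1) x y :
  fexp t Gt (l, x) (l, y) = expR (- (rate l * t)) * fexp t (G l.+1) x y.
Proof.
rewrite -(@fexp_shift _ _ _ (killed l)) // /fexp; congr (limn (series _)).
by apply/funext => k; rewrite fpow_Gtilde_diag.
Qed.

Lemma fexp_Gtilde_slope (l l' : 'I_n.+1) x y : l' = l.+1 :> nat ->
  fexp h Gt (l, x) (l', y) / h @[h --> 0^'+] --> q l' * (x == y)%:R.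
Proof.
move=> ll'; rewrite ll' -(@Gtilde_next (l, x) (l', y)) //; apply: fexp_slope.
by rewrite xpair_eqE -val_eqE /= ll' ltn_eqF.
Qed.

Definition lift_pred k (f : pred E) : pred T :=
  fun z => (z.1 == k :> nat) && f z.2.

Lemma sum_lift_pred k (f : pred E) (F : T -> R) : (k <= n)%N ->
  \sum_(z | lift_pred k f z) F z = \sum_(y | f y) F (inord k, y).
Proof.
move=> kn; rewrite big_mkcond (sum_level (l := inord k)).
  by rewrite [RHS]big_mkcond; apply: eq_bigr => y _; rewrite /lift_pred /= inordK ?eqxx.
by move=> z; rewrite -val_eqE /= inordK // /lift_pred => /negbTE ->.
Qed.

Variable s : nat -> R.
Hypothesis hG : forall k, (1 <= k <= n.+1)%N -> is_generator (G k).
Hypothesis hq : forall k, (1 <= k <= n)%N -> 0 < q k.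
Hypothesis hs1 : (0 < n)%N -> 0 < s 1%N.
Hypothesis hs : forall k, (1 <= k < n)%N -> s k < s k.+1.

(* [Grid k L zl]: after the [k]-th switch, the observations [L] of the second
   coordinate, interleaved with the constraints expressing that switch [j]
   occurs in (s_j, s_j + h] for all j > k, form the list [zl h]. *)
Inductive Grid : nat -> seq (R * pred E) -> (R -> seq (R * pred T)) -> Prop :=
| grid_end : Grid n [::] (fun=> [::])
| grid_obs k t f L zl : (k <= n)%N -> ((0 < k)%N -> s k < t) ->
    ((k < n)%N -> t <= s k.+1) -> Grid k L zl ->
    Grid k ((t, f) :: L) (fun h => (t, lift_pred k f) :: zl h)
| grid_switch k L zl : (k < n)%N -> all (fun t => s k.+1 < t) (map fst L) ->
    Grid k.+1 L zl ->
    Grid k L (fun h => [:: (s k.+1, lift_pred k predT),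
                           (s k.+1 + h, lift_pred k.+1 predT) & zl h]).

(** Outer induction on the number [m] of switches to come, inner induction on the observations. *)
Lemma grid_exists m k (L : seq (R * pred E)) : (k + m = n)%N ->
  sorted (fun a b => a <= b) (map fst L) ->
  ((0 < k)%N -> all (fun t => s k < t) (map fst L)) -> exists zl, Grid k L zl.
Proof.
elim: m k L => [|m IHm] k L km.
  rewrite addn0 in km; subst k.
  elim: L => [|[t f] L IH] /= srt ns; first by eexists; exact: grid_end.
  have [||zl gzl] := IH.
  - exact: path_sorted srt.
  - by move=> /ns /andP[].
  eexists; apply: (grid_obs f _ _ _ gzl) => //; first by move=> /ns /andP[].
  by rewrite ltnn.
have kn : (k < n)%N by rewrite -km addnS ltnS leq_addr.
elim: L => [|[t f] L IH] /= srt ks.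
  have [|//|//|zl gzl] := IHm k.+1 [::]; first by rewrite addSnnS.
  by eexists; apply: (grid_switch _ _ gzl).
(* An observation exactly at the switching time goes before the switch: the constraint S_{k+1} >
   s_{k+1} keeps the level at [k] there. *)
have [ts|st] := leP t (s k.+1).
  have [||zl gzl] := IH; first exact: path_sorted srt.
    by move=> /ks /andP[].
  eexists; apply: (grid_obs f (ltnW kn) _ _ gzl) => //; by move=> /ks /andP[].
have all_s : all (fun t => s k.+1 < t) (t :: map fst L).
  have tL := order_path_min le_trans srt.
  by rewrite /= st /=; apply: sub_all tL => u; exact: lt_le_trans.
have [|//|//|zl gzl] := IHm k.+1 ((t, f) :: L); first by rewrite addSnnS.
by eexists; apply: (grid_switch _ _ gzl).
Qed.

(** The joint density of the remaining [m] switching times at the prescribed values, given level [k]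
    at time [b]: a product of exponential densities. *)
Fixpoint grid_const m k (b : R) : R :=
  if m is m'.+1 then
    expR (- (q k.+1 * (s k.+1 - b))) * q k.+1 * grid_const m' k.+1 (s k.+1)
  else 1.

Lemma grid_const_gt0 m k b : (k + m = n)%N -> 0 < grid_const m k b.
Proof.
elim: m k b => [|m IH] k b km /=; first by [].
by rewrite !mulr_gt0 ?expR_gt0 ?IH ?addSnnS ?hq //= -km addnS ltnS leq_addr.
Qed.

(** Memorylessness: staying at level [k] from [b] to [t] contributes the survival factor. *)
Lemma grid_const_shift m k b t : (k + m = n)%N ->
  expR (- (rate k * (t - b))) * grid_const m k t = grid_const m k b.
Proof.
case: m => [|m] km; rewrite /rate.
  by rewrite -km addn0 ltnn mul0r oppr0 expR0 mul1r.
rewrite -km addnS ltnS leq_addr /= !mulrA -expRD; congr (expR _ * _ * _); ring.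
Qed.

Let hom := hom_trans Gt.
Let inh := inh_trans n G s.

Lemma grid_cvg k0 L0 zl0 : Grid k0 L0 zl0 -> forall m (a : R -> R) b x,
  (k0 + m = n)%N -> a h @[h --> 0^'+] --> b -> sk s k0 <= b ->
  path (fun a b => a <= b) b (map fst L0) -> ((k0 < n)%N -> b <= s k0.+1) ->
  wprob hom (a h) (inord k0, x) (zl0 h) / h ^+ m @[h --> 0^'+] -->
    grid_const m k0 b * wprob inh b x L0.
Proof.
(* Between switches the diagonal block is a survival factor times the exponential of one generator,
   and it is continuous in the elapsed time. *)
have cvg_diag k t (a : R -> R) b x y : (k <= n)%N -> a h @[h --> 0^'+] --> b ->
    sk s k <= b -> b <= t -> ((k < n)%N -> t <= s k.+1) ->
    hom (a h) t (inord k, x) (inord k, y) @[h --> 0^'+] -->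
      expR (- (rate k * (t - b))) * inh b t x y.
  move=> kn ab kb bt tk; rewrite /inh (inh_transE G hs1 hs kn kb bt tk).
  have := @fexp_Gtilde_diag (t - b) (inord k) x y; rewrite inordK // => <-.
  rewrite /hom /hom_trans.
  have ta : t - a h @[h --> 0^'+] --> t - b by apply: cvgB => //; exact: cvg_cst.
  exact: (continuous_cvg _ (@continuous_fexp _ _ Gt _ _ _) ta).
elim=> {k0 L0 zl0} [|k t f L zl kn kt tk g IH|k L zl kn sL g IH] m a b x km ab kb bL bk.
- have -> : m = 0%N by apply/eqP; rewrite -(eqn_add2l n) km addn0.
  by rewrite /= mulr1; under eq_fun do rewrite expr0 divr1; exact: cvg_cst.
- have /andP[bt tL] := bL.
  rewrite (_ : (fun h => _) = fun h => \sum_(y | f y)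
      hom (a h) t (inord k, x) (inord k, y) *
      (wprob hom t (inord k, y) (zl h) / h ^+ m)); last first.
    apply/funext => h /=; rewrite sum_lift_pred // mulr_suml.
    by apply: eq_bigr => y _; rewrite mulrA.
  rewrite /= mulr_sumr; apply: cvg_fsum => y fy.
  rewrite -(@grid_const_shift m k b t) //.
  rewrite [X in _ --> X](_ : _ = (expR (- (rate k * (t - b))) * inh b t x y) *
     (grid_const m k t * wprob inh t y L)); last by ring.
  apply: cvgM; first exact: cvg_diag.
  by apply: (IH m (fun=> t)) => //; [exact: cvg_cst|exact: le_trans bt].
- case: m km => [|m] km; first by rewrite -km addn0 ltnn in kn.
  have {bk} bk := bk kn.
  pose u := s k.+1.
  have uL : path (fun a b => a <= b) u (map fst L).
    case: (map fst L) sL bL => //= t r /andP[ut _] /andP[_ ->].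
    by rewrite ltW.
  (* Of [h ^+ m.+1], one factor normalises the jump block over [u, u + h]; the others go to the
     later switches. *)
  rewrite (_ : (fun h => _) = fun h => \sum_(y : E)
      hom (a h) u (inord k, x) (inord k, y) *
      \sum_(z : E) (fexp h Gt (inord k, y) (inord k.+1, z) / h) *
      (wprob hom (u + h) (inord k.+1, z) (zl h) / h ^+ m)); last first.
    apply/funext => h /=; rewrite sum_lift_pred 1?ltnW // mulr_suml.
    apply: eq_bigr => y _; rewrite -mulrA sum_lift_pred // mulr_suml.
    congr (_ * _); apply: eq_bigr => z _.
    by rewrite {1}/hom /hom_trans addrAC subrr add0r exprS invfM; ring.
  have b0 : 0 <= b by apply: le_trans kb; apply: (sk_le hs1 hs (leq0n k)); exact: ltnW.
  (* The time [u] is absent from the limiting weight and is inserted there to match the grid. *)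
  rewrite /inh (wprob_inh_CK hG hs1 hs x b0 bk uL) -/inh mulr_sumr.
  apply: cvg_fsum => y _ /=.
  rewrite [X in _ --> X](_ : _ = (expR (- (rate k * (u - b))) * inh b u x y) *
     (\sum_z q k.+1 * (y == z)%:R * (grid_const m k.+1 u * wprob inh u z L))).
    apply: cvgM; first by apply: cvg_diag => //; exact: ltnW.
    apply: cvg_fsum => z _; apply: cvgM.
      have := @fexp_Gtilde_slope (inord k) (inord k.+1) y z.
      by rewrite !inordK // ?ltnS 1?ltnW //; apply.
    apply: IH => //.
    - by rewrite addSnnS.
    - rewrite -[X in _ --> X]addr0; apply: cvgD; first exact: cvg_cst.
      exact/cvg_at_right_filter/cvg_id.
    - by move=> kn'; rewrite ltW // hs.
  (* The limiting jump block is a multiple of the identity: a switch does not move the coordinate in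
     [E]. *)
  rewrite (bigD1 y) //= eqxx mulr1 big1 ?addr0; last first.
    by move=> z; rewrite eq_sym => /negbTE ->; rewrite mulr0 mul0r.
  by rewrite /rate kn -/u; ring.
Qed.

End BlockGenerator.

(** * Switching times of a path *)

Section HittingTimes.
Variables (R : realType) (n : nat) (Om : Type) (N : R -> Om -> 'I_n.+1) (w : Om).
Hypothesis rc : forall t, 0 <= t ->
  exists2 e : R, 0 < e & forall u, t <= u < t + e -> N u w = N t w.

(** Level [k] is visited arbitrarily soon after the infimum, and [N] is constant just after it, so
    the infimum is itself a visit. *)
Lemma hit_time_le k (c : R) : (hit_time N k w <= c%:E)%E <->
  exists2 t, 0 <= t <= c & N t w = k :> nat.
Proof.
split=> [|[t /andP[t0 tc] Nt]]; last first.
  apply: (@le_trans _ _ t%:E); last by rewrite lee_fin.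
  by apply: ereal_inf_lbound; exists t.
rewrite /hit_time; set S := [set _ | _ in _] => Sc.
have S0 : (0 <= ereal_inf S)%E.
  by apply: le_ereal_inf_tmp => _ [t [t0 _] <-]; rewrite lee_fin.
have [r rE] : exists r, ereal_inf S = r%:E.
  by case: (ereal_inf S) Sc S0 => // r _ _; exists r.
move: Sc S0; rewrite rE !lee_fin => rc' r0.
have [e e0 re] := rc r0.
have [|_ [t [t0 Nt] <-]] := @ereal_inf_lt _ S (r + e)%:E.
  by rewrite rE lte_fin ltrDl.
rewrite lte_fin => tre.
have rt : r <= t.
  by rewrite -lee_fin -rE; apply: ereal_inf_lbound; exists t.
by exists r; rewrite ?r0 // -(re t) // rt.
Qed.

(** Lets countably many times decide measurability and monotonicity. *)
Lemma rational_right (t c : R) : 0 <= t -> t < c ->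
  exists2 r : rat, t < ratr r < c & N (ratr r) w = N t w.
Proof.
move=> t0 tc; have [e e0 te] := rc t0.
have tm : t < Num.min c (t + e) by rewrite lt_min tc ltrDl.
have [r] := rat_in_itvoo tm.
rewrite in_itv /= lt_min => /and3P[tr rc' re].
by exists r; rewrite ?tr // te // (ltW tr).
Qed.

Hypothesis mono : forall t u, 0 <= t -> t <= u -> (N t w <= N u w)%N.

(** The hitting condition gives N < j at [s j] and N >= j at [s j + h]. As the windows do not
    overlap, monotonicity turns the bounds of neighbouring switches into equalities; at the ends,
    the range 0..n of levels does it. *)
Lemma switch_event (s : nat -> R) (h : R) :
  0 < h -> (forall k, (1 <= k <= n)%N -> 0 < s k) ->
  (forall k, (1 <= k < n)%N -> s k + h <= s k.+1) ->
  (forall k, (1 <= k <= n)%N ->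
    ((s k)%:E < hit_time N k w <= (s k + h)%:E)%E) <->
  (forall k, (1 <= k <= n)%N ->
    N (s k) w = k.-1 :> nat /\ N (s k + h) w = k :> nat).
Proof.
move=> h0 s0 gap; split=> [hit k kn|sw k kn].
  have before j : (1 <= j <= n)%N -> (N (s j) w < j)%N.
    move=> jn; have /andP[sj /hit_time_le[t /andP[t0 tj] Nt]] := hit j jn.
    have st : s j < t.
      rewrite ltNge; apply: contraPN sj => ts; apply/negP; rewrite -leNgt.
      by apply/hit_time_le; exists t; rewrite ?t0.
    have Nj : (N (s j) w <= j)%N by rewrite -[leqRHS]Nt mono ?ltW ?s0.
    rewrite ltn_neqAle Nj andbT.
    apply: contraPneq sj => Nsj; apply/negP; rewrite -leNgt.
    by apply/hit_time_le; exists (s j); rewrite ?lexx ?ltW ?s0.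
  have after j : (1 <= j <= n)%N -> (j <= N (s j + h)%R w)%N.
    move=> jn; have /andP[_ /hit_time_le[t /andP[t0 tj] Nt]] := hit j jn.
    by rewrite -[leqLHS]Nt; exact: mono.
  have /andP[k1 kn'] := kn.
  split; apply/eqP; rewrite eqn_leq.
    rewrite -ltnS prednK // before //=.
    case: k k1 kn kn' => [//|[//|k]] _ _ kn'.
    have kn2 : (1 <= k.+1 <= n)%N by exact: ltnW kn'.
    rewrite (leq_trans (after k.+1 kn2)) // mono //.
      by rewrite addr_ge0 ?ltW ?s0.
    exact: gap.
  rewrite after // andbT; move: kn'; rewrite leq_eqVlt => /orP[/eqP ->|kn'].
    by rewrite -ltnS.
  rewrite -ltnS; apply: leq_ltn_trans (before k.+1 _) => //.
  by apply: mono; [rewrite addr_ge0 ?ltW ?s0|apply: gap; rewrite k1].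
have [Nk Nkh] := sw k kn; have /andP[k1 _] := kn.
apply/andP; split; last first.
  by apply/hit_time_le; exists (s k + h); rewrite ?lexx ?addr_ge0 ?ltW ?s0.
rewrite ltNge; apply/negP => /hit_time_le[t /andP[t0 ts] Nt].
by have := mono t0 ts; rewrite Nt Nk -ltnS prednK // ltnn.
Qed.

End HittingTimes.

(** * Comparison of grid events with switches and observations along one path *)

Section GridEvents.
Variables (R : realType) (E : finType) (n : nat) (s : nat -> R).
Hypothesis hs1 : (0 < n)%N -> 0 < s 1%N.
Hypothesis hs : forall k, (1 <= k < n)%N -> s k < s k.+1.
Let T : finType := ('I_n.+1 * E)%type.
Variables (Om : Type) (Z : R -> Om -> T) (w : Om).
Implicit Types (L : seq (R * pred E)) (zl : R -> seq (R * pred T)) (h : R).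

Definition switch_at h k :=
  (Z (s k) w).1 = k.-1 :> nat /\ (Z (s k + h) w).1 = k :> nat.

(** Smallness of [h]: each window of length [h] ends before the next switching time and before every
    later observation. *)
Definition separated h (ts : seq R) :=
  (forall k, (1 <= k < n)%N -> s k + h <= s k.+1) /\
  {in ts, forall t k, (1 <= k <= n)%N -> s k < t -> s k + h <= t}.

Lemma near_separated (ts : seq R) : \forall h \near 0^'+, separated h ts.
Proof.
have gapP (a b : R) : \forall h \near 0^'+, a < b -> a + h <= b.
  have [ab|ba] := ltP a b; last by near=> h.
  near=> h; move=> _; rewrite -lerBrDl; apply: ltW; near: h.
  by apply: nbhs_right_lt; rewrite subr_gt0.
have gapI (I : finType) (a b : I -> R) :
    \forall h \near 0^'+, forall i, a i < b i -> a i + h <= b i.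
  by apply: filter_forall => i; exact: gapP.
apply: filterI.
  apply: filterS (gapI 'I_n.+1 (fun k => s k) (fun k => s k.+1)).
  move=> h hgap k /andP[k1 kn].
  by apply: (hgap (Ordinal (ltnW kn : (k < n.+1)%N))); apply: hs; rewrite k1.
elim: ts => [|t ts IH]; first exact: filterE.
apply: filterS2 IH (gapI 'I_n.+1 (fun k => s k) (fun=> t)) => h IH hgap u.
rewrite inE => /orP[/eqP -> k /andP[_ kn]|uts]; last exact: IH.
exact: (hgap (Ordinal (kn : (k < n.+1)%N))).
Unshelve. all: by end_near. Qed.

Lemma wev_grid_sound k L zl h : Grid s k L zl -> wev Z (zl h) w ->
  wev (fun t w => (Z t w).2) L w /\
  (forall j, (k < j <= n)%N -> switch_at h j).
Proof.
elim=> {k L zl} [|k t f L zl _ _ _ _ IH|k L zl kn _ _ IH].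
- by split=> // j /andP[/leq_trans nj /nj]; rewrite ltnn.
- rewrite /wev /= => /andP[/andP[_ ft] /IH[Lw sw]]; split=> //.
  by rewrite ft.
rewrite /wev /= => /and3P[/andP[/eqP Nk _] /andP[/eqP Nkh _] /IH[Lw sw]].
split=> // j /andP[]; rewrite leq_eqVlt => /orP[/eqP <- _|kj jn].
  by split.
by apply: sw; rewrite kj.
Qed.

Hypothesis mono : forall t u, 0 <= t -> t <= u -> ((Z t w).1 <= (Z u w).1)%N.

(** The level at an observation between two switches is squeezed by monotonicity between its values
    at [s k + h] and at [s k.+1]. *)
Lemma wev_grid_complete k L zl h : Grid s k L zl -> 0 < h ->
  separated h (map fst L) -> nonneg_times L ->
  (forall j, (1 <= j <= n)%N -> switch_at h j) ->
  wev (fun t w => (Z t w).2) L w -> wev Z (zl h) w.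
Proof.
move=> g h0 + + sw; elim: g => {k L zl} [|k t f L zl kn kt tk _ IH|k L zl kn _ _ IH].
- by [].
- move=> [gap sep] /= /andP[t0 L0] /andP[/= ft Lw].
  apply/andP; split; last first.
    by apply: IH => //; split=> // u uL; apply: sep; rewrite inE uL orbT.
  rewrite /lift_pred /= ft andbT eqn_leq; apply/andP; split.
    have [kn'|nk] := ltnP k n; last by rewrite (leq_trans _ nk) // -ltnS.
    have [Nk _] := sw k.+1 kn'; rewrite -[leqRHS]Nk.
    by apply: mono => //; exact: tk.
  case: k {IH} kn kt tk => [//|k] kn kt tk.
  have [_ Nk] := sw k.+1 kn; rewrite -[leqLHS]Nk.
  apply: mono; last by apply: sep; [rewrite mem_head| |exact: kt].
  by rewrite addr_ge0 // ?(ltW h0) // (sk_le hs1 hs (leq0n k.+1)).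
move=> sep L0 Lw; have [Nk Nkh] := sw k.+1 kn.
rewrite /wev /= /lift_pred Nk Nkh !eqxx /=; exact: IH.
Qed.

End GridEvents.

(** * Chronological order of the grid times, as the Markov property requires *)

Section GridTimes.
Variables (R : realType) (E : finType) (n : nat) (s : nat -> R).

Lemma grid_path k (L : seq (R * pred E)) zl h b : Grid (n := n) s k L zl -> 0 < h ->
  separated n s h (map fst L) -> path (fun a b => a <= b) b (map fst L) ->
  ((k < n)%N -> b <= s k.+1) -> path (fun a b => a <= b) b (map fst (zl h)).
Proof.
move=> g h0; elim: g b => {k L zl} [//|k t f L zl kn kt tk _ IH|k L zl kn sL _ IH] b.
  move=> [gap sep] /= /andP[bt tL] bk; rewrite bt /=; apply: IH => //.
  by split=> // u uL; apply: sep; rewrite inE uL orbT.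
move=> [gap sep] bL bk /=; rewrite bk //= lerDl (ltW h0) /=; apply: IH => //.
  case: (map fst L) sL sep bL => //= t r /andP[st _] sep /andP[_ ->].
  by rewrite andbT; apply: sep; rewrite ?mem_head.
by move=> kn'; apply: gap.
Qed.

End GridTimes.

(** * The chain conditioned on its switching times *)

Lemma path_start (R : realType) (E : finType) (L : seq (R * pred E)) :
  nonneg_times L -> sorted (fun a b => a <= b) (map fst L) ->
  path (fun a b => a <= b) 0 (map fst L).
Proof. by case: L => //= -[t f] L /andP[/= -> _]. Qed.

Lemma sub_bigcup_unpickle (Om : Type) (T : countType) (F : T -> set Om) (x : T) :
  F x `<=` \bigcup_j oapp F set0 (unpickle j).
Proof. by move=> w Fw; exists (pickle x); rewrite ?pickleK. Qed.

(** Both sets are compared outside a measurable null set covering [N]. *)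
Lemma eq_measure_negligible (R : realType) d (Om : measurableType d)
    (mu : {measure set Om -> \bar R}) (N A B : set Om) :
  measurable A -> measurable B -> mu.-negligible N ->
  A `\` N = B `\` N -> mu A = mu B.
Proof.
move=> mA mB [N' [mN' N'0 NN']] AB.
have off C : measurable C -> mu C = mu (C `\` N').
  move=> mC; rewrite (measureDI mu mC mN') [X in (_ + X)%E](_ : _ = 0%E) ?adde0 //.
  apply/eqP; rewrite eq_le measure_ge0 andbT -N'0.
  by apply: le_measure; rewrite ?inE //; exact: measurableI.
rewrite (off A) // (off B) //; congr (mu _).
have DN C : C `\` N' = (C `\` N) `\` N' by rewrite setDDl ((setUidPr _ _).2 NN').
by rewrite DN AB -DN.
Qed.

Section ConditionedChain.
Variables (R : realType) (E : finType) (n : nat) (G : nat -> fmat R E).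
Variable q : nat -> R.
Hypothesis hG : forall k, (1 <= k <= n.+1)%N -> is_generator (G k).
Hypothesis hq : forall k, (1 <= k <= n)%N -> 0 < q k.
Context (d : measure_display) (Om : measurableType d) (Pt : probability Om R).
Variable Z : R -> Om -> ('I_n.+1 * E)%type.
Let hom := hom_trans (@Gtilde R E n G q).
Hypothesis hZ : is_MC Pt Z hom.
Hypothesis hZrc : forall w t, 0 <= t ->
  exists2 e : R, 0 < e & forall u, t <= u < t + e -> Z u w = Z t w.

Let N t w := (Z t w).1.
Let Y t w := (Z t w).2.

Let mZ t x : 0 <= t -> measurable (Z t @^-1` [set x]) := @hZ.1 t x.

Let rcN w t : 0 <= t ->
  exists2 e : R, 0 < e & forall u, t <= u < t + e -> N u w = N t w.
Proof.
by move=> /(hZrc w)[e e0 te]; exists e => // u /te; rewrite /N => ->.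
Qed.

Lemma measurable_state t (B : set ('I_n.+1 * E)%type) : 0 <= t ->
  measurable (Z t @^-1` B).
Proof. by move=> t0; apply: measurable_fibers => x; exact: mZ. Qed.

Lemma measurable_level_decrease a b : 0 <= a -> 0 <= b ->
  measurable [set w | (N b w < N a w)%N].
Proof.
move=> a0 b0; rewrite (_ : [set _ | _] = \bigcup_(l in [set: 'I_n.+1])
    ((Z a @^-1` [set z : 'I_n.+1 * E | z.1 = l]) `&`
     (Z b @^-1` [set z : 'I_n.+1 * E | (z.1 < l)%N]))).
  apply: fin_bigcup_measurable => [|l _]; first exact: finite_finset.
  by apply: measurableI; exact: measurable_state.
by apply/seteqP; split=> [w ba|w [l _ [/= <-]]] //; exists (N a w).
Qed.

(** Conditioning on the state at [a] leaves transitions to lower levels, whose probabilities vanish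
    by block triangularity. *)
Lemma level_decrease_null a b : 0 <= a -> a <= b ->
  Pt [set w | (N b w < N a w)%N] = 0%E.
Proof.
move=> a0 ab; have b0 := le_trans a0 ab.
have mA := measurable_level_decrease a0 b0.
rewrite (probability_fibers Pt (fun x => mZ x a0) mA) big1 // => x _.
pose f : pred ('I_n.+1 * E)%type := fun z => (z.1 < x.1)%N.
rewrite (_ : _ `&` _ = [set w | Z a w = x] `&` wev Z [:: (b, f)]).
  rewrite (MC_wprob mZ _ hZ) //= ?ab // big1 ?mule0 // => y yx.
  by rewrite mulr1; exact: fexp_Gtilde_lower.
rewrite wev_cons wev_nil setIT; apply/seteqP; split=> w /=.
  by move=> [ba ax]; split=> //; rewrite /f -ax.
by move=> [ax]; rewrite /f -ax.
Qed.

Definition decrease_at (ab : rat * rat) : set Om :=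
  if (0 <= ratr ab.1 :> R) && (ratr ab.1 <= ratr ab.2 :> R)
  then [set w | (N (ratr ab.2) w < N (ratr ab.1) w)%N] else set0.

Definition nonmonotone : set Om :=
  \bigcup_j (oapp decrease_at set0 (unpickle j)).

Lemma nonmonotone_negligible : Pt.-negligible nonmonotone.
Proof.
apply: negligible_bigcup => j; case: (unpickle j) => [[a b]|] /=; last first.
  exact: negligible_set0.
rewrite /decrease_at /=; case: ifP => [/andP[a0 ab]|_]; last exact: negligible_set0.
exists [set w | (N (ratr b) w < N (ratr a) w)%N]; split=> //.
  by apply: measurable_level_decrease => //; exact: le_trans ab.
exact: level_decrease_null.
Qed.

(** Right continuity replaces [t] by a rational in (t,u) and [u] by a rational beyond it, without
    changing the levels. *)
Lemma monotone_levels w : ~ nonmonotone w ->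
  forall t u, 0 <= t -> t <= u -> (N t w <= N u w)%N.
Proof.
move=> nw t u t0; rewrite le_eqVlt => /orP[/eqP -> //|tu].
have [a /andP[ta au] <-] := rational_right (rcN w) t0 tu.
have u0 : 0 <= u by rewrite (le_trans t0) // ltW.
have [b /andP[ub _] <-] := rational_right (rcN w) u0 (ltr_pwDr ltr01 (lexx u)).
rewrite leqNgt; apply/negP => ba; apply/nw/(sub_bigcup_unpickle (x := (a, b))).
by rewrite /decrease_at /= (le_trans t0 (ltW ta)) (le_trans (ltW au) (ltW ub)).
Qed.

(** A visit before [c] is also seen at a rational time before [c]; a visit at [c] itself is recorded
    separately. *)
Lemma measurable_hit_time_le k c : 0 <= c ->
  measurable [set w | (hit_time N k w <= c%:E)%E].
Proof.
move=> c0; pose lvl : set ('I_n.+1 * E)%type := [set z : 'I_n.+1 * E | z.1 = k :> nat].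
rewrite (_ : [set _ | _] = (Z c @^-1` lvl) `|` \bigcup_(r : rat)
    (if (0 <= ratr r :> R) && (ratr r <= c) then Z (ratr r) @^-1` lvl else set0)).
  apply: measurableU; first exact: measurable_state.
  apply: bigcupT_measurable_rat => r.
  by case: ifP => [/andP[r0 _]|_] //; exact: measurable_state.
apply/seteqP; split=> w /=.
  move=> /(hit_time_le (rcN w))[t /andP[t0]].
  rewrite le_eqVlt => /orP[/eqP -> Nc|tc Nt]; first by left.
  have [r /andP[tr rc] Nr] := rational_right (rcN w) t0 tc.
  by right; exists r => //; rewrite (le_trans t0) ?ltW //= /lvl /= -/(N _ w) Nr.
move=> H; apply/(hit_time_le (rcN w)); case: H => [Nc|[r _]].
  by exists c; rewrite ?c0 ?lexx.
by case: ifP => // rc Nr; exists (ratr r).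
Qed.

Variables (i : E) (s : nat -> R).
Hypothesis hs1 : (0 < n)%N -> 0 < s 1%N.
Hypothesis hs : forall k, (1 <= k < n)%N -> s k < s k.+1.
Let start : set Om := [set w | Z 0 w = (ord0, i)].
Hypothesis hZ0 : (0 < Pt start)%E.

Definition switches_in (D : nat -> R) : set Om :=
  [set w | forall k, (1 <= k <= n)%N ->
     ((s k)%:E < hit_time N k w <= (s k + D k)%:E)%E].

Lemma s_gt0 k : (1 <= k <= n)%N -> 0 < s k.
Proof.
case: k => // k kn; apply: le_lt_trans (sk_ltS hs1 hs kn).
exact: (sk_le hs1 hs (leq0n k) (ltnW kn)).
Qed.

Lemma measurable_switches_in D : (forall k, (1 <= k <= n)%N -> 0 < D k) ->
  measurable (switches_in D).
Proof.
move=> D0; rewrite (_ : switches_in D = \bigcap_(k in [set k | (1 <= k <= n)%N])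
   ([set w | (hit_time N k w <= (s k + D k)%:E)%E] `\`
    [set w | (hit_time N k w <= (s k)%:E)%E])).
  apply: bigcap_measurableType => k kn.
  by apply: measurableD; apply: measurable_hit_time_le;
    rewrite ?addr_ge0 ?ltW ?D0 ?s_gt0.
apply/seteqP; split=> w /= H k kn.
  by have /andP[sk kD] := H k kn; split=> //=; apply/negP; rewrite -ltNge.
by have [/= -> /negP] := H k kn; rewrite -ltNge => ->.
Qed.

(** The two events agree wherever the levels are monotone, hence almost surely; the Markov property
    then cancels the initial probability. *)
Lemma cond_prob_grid L zl h : Grid s 0 L zl -> nonneg_times L ->
  sorted (fun a b => a <= b) (map fst L) -> 0 < h -> separated n s h (map fst L) ->
  condP Pt start (wev Y L `&` switches_in (fun=> h)) =
    wprob hom 0 (ord0, i) (zl h).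
Proof.
move=> g L0 srt h0 sep.
have pL := path_start L0 srt.
have pzl : path (fun a b => a <= b) 0 (map fst (zl h)).
  by apply: (grid_path g h0 sep pL) => n0; apply: ltW; exact: hs1.
have zl0 : nonneg_times (zl h) := path_nonneg (lexx 0) pzl.
have mstart : measurable start by exact: mZ.
have mY t x : 0 <= t -> measurable (Y t @^-1` [set x]).
  by move=> t0; apply: (@measurable_state t [set z | z.2 = x]).
rewrite /condP (_ : Pt (_ `&` start) = Pt (start `&` wev Z (zl h))).
  rewrite (MC_wprob mZ _ hZ) // fineM ?fin_num_measure //=.
  rewrite mulrAC mulfV ?mul1r // gt_eqF // fine_gt0 // hZ0 ltey_eq.
  by rewrite fin_num_measure.
apply: eq_measure_negligible nonmonotone_negligible _.
- apply: measurableI => //; apply: measurableI; first exact: measurable_wev.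
  by apply: measurable_switches_in.
- by apply: measurableI => //; exact: measurable_wev.
have main w : ~ nonmonotone w ->
    (wev Y L `&` switches_in (fun=> h)) w <-> wev Z (zl h) w.
  move=> /monotone_levels mono.
  have sw := switch_event (rcN w) mono h0 s_gt0 sep.1.
  split=> [[Lw /sw swts]|zlw].
    exact: (wev_grid_complete hs1 hs mono g h0 sep L0 swts Lw).
  by have [Lw swts] := wev_grid_sound g zlw; split=> //; apply/sw.
apply/seteqP; split=> w [[A B] nw].
  by split=> //; split=> //; apply/(main w nw).
by split=> //; split=> //; apply/(main w nw).
Qed.


Lemma conditioned_limit L : nonneg_times L ->
  sorted (fun a b => a <= b) (map fst L) ->
  condP Pt start (wev Y L `&` switches_in (fun=> h)) /
    condP Pt start (switches_in (fun=> h)) @[h --> 0^'+] -->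
  wprob (inh_trans n G s) 0 i L.
Proof.
move=> L0 srt.
have pL := path_start L0 srt.
have [zl g] : exists zl, Grid (n := n) s 0 L zl by exact: (@grid_exists _ _ _ s n).
(* The grid without observations describes the conditioning event alone. *)
have [zl0 g0] : exists zl, Grid (E := E) (n := n) s 0 [::] zl.
  exact: (@grid_exists _ _ _ s n).
have c0 := grid_const_gt0 s hq 0 (erefl (0 + n)%N).
have s1 : (0 < n)%N -> 0 <= s 1%N by move=> /hs1 /ltW.
have lim L' zl' : Grid s 0 L' zl' ->
    path (fun a b => a <= b) 0 (map fst L') ->
    wprob hom 0 (inord 0, i) (zl' h) / h ^+ n @[h --> 0^'+] -->
      grid_const q s n 0 0 * wprob (inh_trans n G s) 0 i L'.
  move=> g' pL'; apply: (grid_cvg hG hs1 hs g' (a := fun=> 0)) => //.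
  exact: cvg_cst.
have lL := lim _ _ g pL; have l0 := lim _ _ g0 isT.
(* Numerator and denominator, each divided by [h ^+ n], have limits with the same density factor,
   which cancels. *)
rewrite [X in _ --> X](_ : _ = (grid_const q s n 0 0 * wprob (inh_trans n G s) 0 i L) /
   (grid_const q s n 0 0 * wprob (inh_trans n G s) 0 i [::])); last first.
  by rewrite /= mulr1 mulrAC mulfV ?mul1r // gt_eqF.
apply: cvg_trans (cvgM lL (cvgV _ l0)); last by rewrite mulr1 gt_eqF.
apply: near_eq_cvg; near=> h.
have h0 : 0 < h by near: h; exact: nbhs_right_gt.
have io : inord 0 = ord0 :> 'I_n.+1 by apply/val_inj; rewrite /= inordK.
rewrite (cond_prob_grid g) //; last by near: h; exact: near_separated.
rewrite -[switches_in _]setTI -(wev_nil Y) (cond_prob_grid g0) //; last first.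
  by near: h; exact: near_separated.
rewrite io /= invfM invrK mulrACA mulVf ?mulr1 //.
by rewrite expf_neq0 // gt_eqF.
Unshelve. all: by end_near. Qed.

End ConditionedChain.

Theorem theorem3p4 (R : realType) (E : finType) (n : nat)
  (G : nat -> fmat R E) (q : nat -> R)
  (hG : forall k, (1 <= k <= n.+1)%N -> is_generator (G k))
  (hq : forall k, (1 <= k <= n)%N -> 0 < q k)
  (d : measure_display) (Om : measurableType d) (Pt : probability Om R)
  (Z : R -> Om -> ('I_n.+1 * E)%type)
  (hZ : is_MC Pt Z (hom_trans (@Gtilde R E n G q)))
  (hZrc : forall w t, 0 <= t ->
     exists2 e : R, 0 < e & forall u, t <= u < t + e -> Z u w = Z t w)
  (i : E) (s : nat -> R)
  (hs1 : (0 < n)%N -> 0 < s 1%N)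
  (hs : forall k, (1 <= k < n)%N -> s k < s k.+1)
  (hZ0 : (0 < Pt [set w | Z 0%R w = (ord0, i)])%E)
  (Pbar : probability (g_sigma_algebraType
                         (cyl_sets (fun t w => (Z t w).2))) R)
  (hPbar : forall (u : seq R) (B : set (seq E)),
     all (fun t => 0 <= t) u ->
     forall eps : R, 0 < eps -> exists2 delta : R, 0 < delta &
       forall D : nat -> R, (forall k, (1 <= k <= n)%N -> 0 < D k < delta) ->
       `| condP Pt [set w | Z 0%R w = (ord0, i)]
            (cylinder (fun t w => (Z t w).2) u B `&`
             [set w | forall k, (1 <= k <= n)%N ->
                ((s k)%:E < @hit_time R Om n (fun t w => (Z t w).1) k w
                 <= (s k + D k)%:E)%E])
          / condP Pt [set w | Z 0%R w = (ord0, i)]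
             [set w | forall k, (1 <= k <= n)%N ->
                ((s k)%:E < @hit_time R Om n (fun t w => (Z t w).1) k w
                 <= (s k + D k)%:E)%E]
          - fine (Pbar (cylinder (fun t w => (Z t w).2) u B)) | < eps) :
  let Y : R -> g_sigma_algebraType (cyl_sets (fun t w => (Z t w).2)) -> E :=
    fun t w => (Z t w).2 in
  is_MC Pbar Y (@inh_trans R E n G s) /\
  Pbar [set w | Y 0%R w = i] = 1%E /\
  (forall (d' : measure_display) (Om' : measurableType d')
          (P' : probability Om' R) (X : R -> Om' -> E),
     is_MC P' X (@inh_trans R E n G s) ->
     (0 < P' [set w | X 0%R w = i])%E ->
     forall (u : seq R) (B : set (seq E)), all (fun t => 0 <= t) u ->
       condP P' [set w | X 0%R w = i] (cylinder X u B)
       = fine (Pbar (cylinder Y u B))).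
Proof.
move=> Y.
set start := [set w | Z 0 w = (ord0, i)] in hPbar hZ0.
pose inh := inh_trans n G s.
have mY t x : 0 <= t -> measurable (Y t @^-1` [set x]).
  move=> t0; apply: sub_sigma_algebra.
  exists [:: t], [set [:: x]]; split; first by rewrite /= t0.
  by apply/seteqP; split=> w /=; [move=> Ytx; congr [:: _] | case].
(* All conclusions are read off from this formula for sorted constraints. *)
have law L : nonneg_times L -> sorted (fun a b => a <= b) (map fst L) ->
    Pbar (wev Y L) = (wprob inh 0 i L)%:E.
  move=> L0 srt.
  rewrite -[LHS]fineK ?fin_num_measure //; last exact: measurable_wev.
  congr (_%:E).
  have lim := conditioned_limit hG hq hZ hZrc hs1 hs hZ0 L0 srt.
  apply: (cvg_unique (@norm_hausdorff _ R^o) _ lim).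
  apply/cvgrPdist_lt => eps eps0.
  have u0 : all (fun t => 0 <= t) (map fst L) by rewrite all_map.
  have [delta delta0 hd] := hPbar _ [set ys | all (fun p => p.1.2 p.2) (zip L ys)] u0 eps eps0.
  near=> h; rewrite distrC (cylinder_wev Y).
  (* The limit defining [Pbar] is joint in all increments, so it can be evaluated along equal
     ones. *)
  apply: (hd (fun=> h)) => k _; apply/andP; split; near: h.
    exact: nbhs_right_gt.
  exact: nbhs_right_lt.
have lawp t x (r : seq (R * E)) : 0 <= t ->
    sorted (fun a b : R => a <= b) (t :: map fst r) ->
    Pbar (path_ev Y t x r) = (inh 0 t i x * path_prob inh t x r)%:E.
  move=> t0 tr; rewrite path_evE law ?(wprob_pred1 inh 0 i ((t, x) :: r)) //.
    rewrite /= t0 /=; apply: (path_nonneg t0); by rewrite -map_comp.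
  by rewrite -map_comp.
have inh00 : inh 0 0 = @fid R E.
  rewrite /inh (inh_transE G hs1 hs (leq0n n)) ?subrr ?fexp0 //.
  by move=> /hs1 /ltW.
split; first split=> //.
  move=> t x r t0 tr; rewrite lawp // EFinM; congr (_ * _)%E.
  by rewrite (lawp t x [::]) //= mulr1.
have Y0 : Pbar [set w | Y 0 w = i] = 1%E.
  by rewrite (lawp 0 i [::]) //= inh00 /fid eqxx mulr1.
split=> // d' Om' P' X hX hX0 u B u0.
have mC : measurable [set w | X 0 w = i] by exact: hX.1.
rewrite /condP (cylinder_prob P' B hX.1 mC u0) -[cylinder Y u B]setIT.
rewrite (cylinder_prob Pbar B mY measurableT u0) mulr_suml.
apply: eq_bigr => ys _; rewrite setTI.
(* The times in [u] come in any order, while both laws are known for sorted times. *)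
have L0 : nonneg_times (sort_times (pin_tuple u ys)).
  by rewrite /nonneg_times all_sort_times; exact: nonneg_times_pin.
have srt := sorted_sort_times (pin_tuple u ys).
rewrite -(wev_sort_times X) -(wev_sort_times Y) (MC_wprob hX.1 _ hX) //; last first.
  exact: path_start.
rewrite law // fineM ?fin_num_measure //= mulrAC mulfV ?mul1r //.
by rewrite gt_eqF // fine_gt0 // hX0 ltey_eq fin_num_measure.
Unshelve. all: by end_near. Qed.
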